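(* Suppose the following assumptions hold. (A1) For each $n\ge 1$ and $P_{0,X}^{(\infty)}$-almost every fixed realization $\{x_i\}_{i\ge1}$ of $\{X_i\}_{i\ge1}$, $(y^{(n)},p)\mapsto L_n(p)=\prod_{i=1}^n\prod_{k=1}^K p_k(x_i)^{\mathbf 1\{y_i=y_k\}}$ is measurable on $(\mathcal Y^n\times\mathcal P,2^{\mathcal Y^n}\otimes\mathscr P)$. (A2) For each $n\ge1$ and almost every fixed realization $\{x_i\}_{i\ge1}$: the marginal law of $(p(x_1),\dots,p(x_n))$ under $\Pi$ admits a density $\pi_n$, and $\int L_n(p)\,d\Pi(p)\in(0,\infty)$ a.e. $[P_0^{(n)}]$. (A3) $\Gamma$ is a compact subset of $(\mathbb R^{d_\gamma},\|\cdot\|_2)$. (A4) For each $n\ge1$ and almost every fixed realization $\{x_i\}_{i\ge1}$: $\gamma\mapsto Q_n(\gamma,p)$ is lower semicontinuous for each $p\in\mathcal P$, and $p\mapsto\inf_{\gamma\in A}Q_n(\gamma,p)$ is measurable from $(\mathcal P,\mathscr P)$ to $(\mathbb R_+,\mathcal B(\mathbb R_+))$ for each compact $A\subseteq\Gamma$. (A5) Conditionally on $P_{0,X}^{(\infty)}$-almost every fixed realization $\{x_i\}_{i\ge1}$: (1) the $Y_i$ are independent with $Y_i\sim \mathrm{Categorical}(p_0(x_i))$, where $p_0\in\mathcal P$; (2) for every $\varepsilon>0$ there exist $\xi>0$ and $N\ge1$ such that, for all $n\ge N$, $\tilde Q_n(\gamma,p_0)\ge\xi$ for all $\gamma\in\Gamma\setminus\tilde\Gamma_{n,I}^{\varepsilon}(p_0)$,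 and $\{\gamma\in\Gamma:\tilde Q_n(\gamma,p_0)\ge\xi\}$ is a compact subset of $\Gamma$. (A6) For $P_{0,X}^{(\infty)}$-almost every fixed realization $\{x_i\}_{i\ge1}$ there are semimetrics $d_n$ on $\mathcal P$, a sequence $\delta_n\downarrow0$, and sets $\mathcal P_n\subseteq\mathcal P$ ($n\ge1$) such that, with $V_{n,\delta_n}=\mathcal P_n\cap\{p:d_n(p,p_0)<\delta_n\}$: (1) $\Pi_n(p\in\mathcal P_n|Y^{(n)})\to1$ and $\Pi_n(d_n(p,p_0)<\delta_n|Y^{(n)})\to1$ in $P_0^{(n)}$-probability; (2) $\limsup_{n\to\infty}\sup_{(\gamma,p)\in\Gamma\times V_{n,\delta_n}}|Q_n(\gamma,p)-Q_n(\gamma,p_0)|=0$; (3) for every $\varepsilon>0$ there exists $N\ge1$ such that $p\in V_{n,\delta_n}$ and $n\ge N$ imply $\tilde\Gamma_{n,I}(p)\cap B(\gamma,\varepsilon)\ne\emptyset$ for all $\gamma\in\tilde\Gamma_{n,I}(p_0)$. Then, for $P_{0,X}^{(\infty)}$-almost every fixed realization $\{x_i\}_{i\ge1}$ of $\{X_i\}_{i\ge1}$ and every $\varepsilon>0$, $$\Pi_n\left(d_{\mathcal H}(\tilde\Gamma_{n,I}(p),\tilde\Gamma_{n,I}(p_0))\ge\varepsilon\,\middle|\,Y^{(n)}\right)\to0\quad\text{in }P_0^{(n)}\text{-probability as }n\to\infty.$$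
   Context: $\mathcal Y=\{y_1,\dots,y_K\}$ is finite, $\mathcal X\subseteq\mathbb R^{d_x}$, $\Delta^{K-1}$ is the probability simplex in $\mathbb R^K$. $\{X_i\}_{i\ge1}$ is a sequence of $\mathcal X$-valued random vectors with law $P_{0,X}^{(\infty)}$; the analysis conditions on a realization $\{x_i\}_{i\ge1}$. $\mathcal P$ is a space of conditional PMFs $p=(p_1,\dots,p_K):\mathcal X\to\Delta^{K-1}$ with $\sigma$-algebra $\mathscr P$ and $\Pi$ is a prior, i.e. a probability measure on $(\mathcal P,\mathscr P)$. $\mathrm{Categorical}(p(x))$ is the law on $\mathcal Y$ giving mass $p_k(x)$ to $y_k$. $Y^{(n)}=(Y_1,\dots,Y_n)$ and $P_0^{(n)}=\bigotimes_{i=1}^n\mathrm{Categorical}(p_0(x_i))$, $p_0$ being the true conditional PMF. The posterior is $\Pi_n(A|Y^{(n)})=\int_A L_n\,d\Pi/\int L_n\,d\Pi$, with $L_n$ evaluated at $Y^{(n)}$; events appearing in posterior probabilities concerning $\mathcal P_n$ and $d_n$ are taken to be measurable. $\Gamma\subseteq\mathbb R^{d_\gamma}$ is the structural parameter space and $f:\mathcal X\times\Delta^{K-1}\times\Gamma\to\mathbb R^{d_f}$ a known function. $Q_n:\Gamma\times\mathcal P\to\mathbb R_+$ is a criterion function (it may depend on $x_1,\dots,x_n$) depending on $p$ only through $(p(x_1),\dots,p(x_n))$ and satisfying $Q_n(\gamma,p)=0\iff f(x_i,p(x_i),\gamma)\in\mathbb R_+^{d_f}\ \forall i=1,\dots,n$.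 Define $\tilde Q_n(\gamma,p)=Q_n(\gamma,p)-\inf_{\tilde\gamma\in\Gamma}Q_n(\tilde\gamma,p)$ and the pseudo-identified set $\tilde\Gamma_{n,I}(p)=\{\gamma\in\Gamma:\tilde Q_n(\gamma,p)=0\}$. $\mathrm{dist}$ is Euclidean distance from a point to a set, $\tilde\Gamma_{n,I}^\varepsilon(p)=\{\gamma\in\Gamma:\mathrm{dist}(\gamma,\tilde\Gamma_{n,I}(p))<\varepsilon\}$, $B(\gamma,\varepsilon)$ is the open Euclidean ball, and $d_{\mathcal H}(\Gamma_1,\Gamma_2)=\max\{\sup_{\gamma\in\Gamma_1}\mathrm{dist}(\gamma,\Gamma_2),\sup_{\gamma\in\Gamma_2}\mathrm{dist}(\gamma,\Gamma_1)\}$ is the Hausdorff distance. Compact sets $A$ in (A4) are taken nonempty. *)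

(* Defs.v *)
From HB Require Import structures.
From mathcomp Require Import all_boot all_order all_algebra.
From mathcomp Require Import all_classical all_reals all_analysis.

Set Implicit Arguments.
Unset Strict Implicit.
Unset Printing Implicit Defensive.

Import Order.TTheory GRing.Theory Num.Theory.
Import numFieldNormedType.Exports.

Local Open Scope classical_set_scope.
Local Open Scope ring_scope.

(* The library topology on 'rV[R]_d is the Euclidean one, but its norm is the
   sup norm, so distances are computed from [norm2]. *)
Definition norm2 (R : realType) (d : nat) (v : 'rV[R]_d) : R :=
  Num.sqrt (\sum_(j < d) v 0 j ^+ 2).

Definition ball2 (R : realType) (d : nat) (v : 'rV[R]_d) (e : R) :
    set 'rV[R]_d :=
  [set u | norm2 (u - v) < e].

(* Extended-real valued: the distance to the empty set is +oo. *)
Definition dist2 (R : realType) (d : nat) (v : 'rV[R]_d) (S : set 'rV[R]_d) :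
    \bar R :=
  ereal_inf [set (norm2 (v - s))%:E | s in S].

Definition hausdorff2 (R : realType) (d : nat) (S T : set 'rV[R]_d) : \bar R :=
  Order.max (ereal_sup [set dist2 s T | s in S])
            (ereal_sup [set dist2 t S | t in T]).

(* No separation axiom: distinct points may be at distance 0. *)
Definition semimetric (R : realType) (T : Type) (dd : T -> T -> R) : Prop :=
  [/\ forall p q, 0 <= dd p q,
      forall p, dd p p = 0,
      forall p q, dd p q = dd q p
    & forall p q r, dd p r <= dd p q + dd q r].

(* R^d with its Borel sigma-algebra. *)
Definition borel_rV (R : realType) (d : nat) :=
  g_sigma_algebraType (@open 'rV[R]_d).

Definition cylinder (R : realType) (d : nat) : set (set (nat -> 'rV[R]_d)) :=
  [set A | exists i (B : set (borel_rV R d)),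
     measurable B /\ A = [set x | B (x i)]].

(* Sequences in R^d with the product sigma-algebra; the term numbered i >= 1 in
   the usual indexing is [x i.-1]. *)
Definition seq_rV (R : realType) (d : nat) :=
  g_sigma_algebraType (@cylinder R d).

Definition init_tuple (T : Type) (n : nat) (x : nat -> T) : n.-tuple T :=
  [tuple x i | i < n].

(* K = k.+1 categories throughout (the simplex in R^0 is empty). *)
Definition simplex (R : realType) (k : nat) : set 'rV[R]_k.+1 :=
  [set w | (forall j, 0 <= w 0 j) /\ \sum_(j < k.+1) w 0 j = 1].

(* The sample space of (Y_1, ..., Y_n), with its power set as sigma-algebra;
   the label y_j is identified with j. *)
Definition obs (k n : nat) : Type := n.-tuple 'I_k.+1.

HB.instance Definition _ (k n : nat) := Finite.on (obs k n).
HB.instance Definition _ (k n : nat) :=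
  isPointed.Build (obs k n) (nseq_tuple n ord0).
HB.instance Definition _ (k n : nat) :=
  @isMeasurable.Build default_measure_display (obs k n)
    discrete_measurable discrete_measurable0
    discrete_measurableC discrete_measurableU.

(* The law of n independent observations, the i-th one being
   Categorical(w i). *)
Definition data_law (R : realType) (k : nat) (w : nat -> 'rV[R]_k.+1)
    (n : nat) (A : set (obs k n)) : R :=
  \sum_(y : obs k n | y \in A) \prod_(i < n) w i 0 (tnth y i).

Definition cvg_in_data_law (R : realType) (k : nat) (w : nat -> 'rV[R]_k.+1)
    (Z : forall n, obs k n -> R) (c : R) : Prop :=
  forall eta : R, 0 < eta ->
    data_law w [set y : obs k n | eta <= `|Z n y - c|] @[n --> \oo] --> (0 : R).

Section posterior.
Context {R : realType} {k dx : nat} {dP : measure_display}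
  {P : measurableType dP}.
(* [ev p x] is the probability vector p(x). *)
Variable ev : P -> 'rV[R]_dx -> 'rV[R]_k.+1.

Definition likelihood (x : nat -> 'rV[R]_dx) (n : nat) (y : obs k n) (p : P) :
    R :=
  \prod_(i < n) \prod_(j < k.+1) ev p (x i) 0 j ^+ (tnth y i == j).

Definition posterior (Pi : probability P R) (x : nat -> 'rV[R]_dx) (n : nat)
    (y : obs k n) (A : set P) : R :=
  (\int[Pi]_(p in A) likelihood x y p) / (\int[Pi]_p likelihood x y p).

Definition marginal (x : nat -> 'rV[R]_dx) (n : nat) (p : P) :
    n.-tuple (borel_rV R k.+1) :=
  [tuple ev p (x i) | i < n].

End posterior.

(* The law of g under mu has a density with respect to nu. *)
Definition has_density (R : realType) (d d' : measure_display)
    (T : measurableType d) (T' : measurableType d')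
    (mu : {measure set T -> \bar R}) (g : T -> T')
    (nu : {measure set T' -> \bar R}) : Prop :=
  measurable_fun setT g /\
  exists h : T' -> R,
    [/\ measurable_fun setT h,
        forall z, 0 <= h z
      & forall B, measurable B ->
          mu (g @^-1` B) = (\int[nu]_(z in B) (h z)%:E)%E].

Section criterion.
Context {R : realType} {dg : nat} {P : Type}.
(* [q] is the criterion for a fixed sample size and fixed covariates. *)
Variables (Gam : set 'rV[R]_dg) (q : 'rV[R]_dg -> P -> R).

Definition Qtilde (g : 'rV[R]_dg) (p : P) : R :=
  q g p - inf [set q g' p | g' in Gam].

Definition pseudo_id (p : P) : set 'rV[R]_dg :=
  [set g | Gam g /\ Qtilde g p = 0].

Definition pseudo_id_nbhd (e : R) (p : P) : set 'rV[R]_dg :=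
  [set g | Gam g /\ (dist2 g (pseudo_id p) < e%:E)%E].

End criterion.

(* Main.v *)
Require Import Defs.
From HB Require Import structures.
From mathcomp Require Import all_boot all_order all_algebra.
From mathcomp Require Import all_classical all_reals all_analysis.
From mathcomp Require Import ring lra.
Set Implicit Arguments.
Unset Strict Implicit.
Unset Printing Implicit Defensive.
Import Order.TTheory GRing.Theory Num.Theory.
Import numFieldNormedType.Exports.
Local Open Scope classical_set_scope.
Local Open Scope ring_scope.

(** On [V_n] the criteria at [p] and [p0] are uniformly close, so a minimizer
    for [p] has a small pseudo-criterion at [p0] and, by the separation
    condition (A5), lies near the pseudo-identified set of [p0]; the converse
    inclusion is (A6)(3). Hence for large [n] the event
    [d_H >= eps] is disjoint from [V_n], whose complement has vanishing
    posterior probability. The event is measurable because [p] enters only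
    through the hitting events [I(p) `&` A !=set0], [A] closed, and by lower
    semicontinuity and compactness such an event says that the infima of the
    criterion over [Gam `&` A] and over [Gam] coincide. *)

(** * Euclidean norm and distance to a set *)

(** Cauchy-Schwarz: the nonnegative sum of the [(B * a j - C * b j) ^+ 2] equals
    [B * (A * B - C ^+ 2)], and one divides by [B]. If [B = 0], every [b j] vanishes. *)
Lemma sum_mul_sqr_le (R : realType) (d : nat) (a b : 'I_d -> R) :
  (\sum_j a j * b j) ^+ 2 <= (\sum_j a j ^+ 2) * (\sum_j b j ^+ 2).
Proof.
set A := \sum_j a j ^+ 2; set B := \sum_j b j ^+ 2; set C := \sum_j a j * b j.
have A0 : 0 <= A by apply: sumr_ge0 => j _; exact: sqr_ge0.
have B0 : 0 <= B by apply: sumr_ge0 => j _; exact: sqr_ge0.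
have : 0 <= \sum_j (B * a j - C * b j) ^+ 2.
  by apply: sumr_ge0 => j _; exact: sqr_ge0.
have -> : \sum_j (B * a j - C * b j) ^+ 2 = B * (A * B - C ^+ 2).
  transitivity (\sum_j (B ^+ 2 * a j ^+ 2 + (- (2 * B * C) * (a j * b j)
                       + C ^+ 2 * b j ^+ 2))).
    by apply: eq_bigr => j _; ring.
  by rewrite !big_split -!mulr_sumr /= -/A -/B -/C; ring.
have [B_gt0|B_le0 _] := ltP 0 B; first by rewrite pmulr_rge0// subr_ge0.
have BE : B = 0 by apply/le_anti; rewrite B0 B_le0.
have b0 j : b j = 0.
  apply/eqP; rewrite -sqrf_eq0; apply/eqP.
  by move/psumr_eq0P: BE; apply => // i _; exact: sqr_ge0.
by rewrite /C big1 ?expr0n ?mulr_ge0// => j _; rewrite b0 mulr0.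
Qed.

Section norm2.
Context {R : realType} {d : nat}.
Implicit Types u v w : 'rV[R]_d.

Lemma norm2_ge0 u : 0 <= norm2 u.
Proof. exact: sqrtr_ge0. Qed.

Lemma norm2D u v : norm2 (u + v) <= norm2 u + norm2 v.
Proof.
have S0 w : 0 <= \sum_(j < d) w 0 j ^+ 2.
  by apply: sumr_ge0 => j _; exact: sqr_ge0.
rewrite -(@ler_pXn2r _ 2)// ?nnegrE ?addr_ge0 ?norm2_ge0//.
rewrite sqrrD /norm2 !sqr_sqrtr//.
have -> : \sum_(j < d) (u + v) 0 j ^+ 2 = \sum_(j < d) u 0 j ^+ 2
    + (\sum_(j < d) u 0 j * v 0 j) *+ 2 + \sum_(j < d) v 0 j ^+ 2.
  rewrite -sumrMnl -!big_split /=.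
  by apply: eq_bigr => j _; rewrite !mxE sqrrD.
rewrite lerD2r lerD2l lerMn2r /= -sqrtrM//.
apply: (le_trans (ler_norm _)); rewrite -sqrtr_sqr ler_wsqrtr//.
exact: sum_mul_sqr_le.
Qed.

Lemma norm2_sym u v : norm2 (u - v) = norm2 (v - u).
Proof.
rewrite /norm2; congr Num.sqrt; apply: eq_bigr => j _.
by rewrite !mxE -sqrrN opprB.
Qed.

Lemma norm2_triangle w u v : norm2 (u - v) <= norm2 (u - w) + norm2 (w - v).
Proof. by rewrite (le_trans _ (norm2D _ _))// addrA subrK. Qed.

Lemma norm2_continuous v : continuous (fun u => norm2 (u - v)).
Proof.
move=> u; apply: (@continuous_comp _ _ _ (fun u : 'rV[R]_d =>
  \sum_(j < d) (u - v) 0 j ^+ 2) Num.sqrt); last exact: sqrt_continuous.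
rewrite (_ : (fun z : 'rV[R]_d => _) =
             \sum_(j < d) (fun z => (z - v) 0 j ^+ 2)); last first.
  by apply/funext => z; rewrite fct_sumE.
elim/big_ind: _ => [|f g fc gc|j _]; first exact: cst_continuous.
  exact: continuousD.
rewrite (_ : (fun z => _) = (fun z : 'rV[R]_d => (z 0 j - v 0 j) ^+ 2)).
  apply: (@continuous_comp _ _ _ (fun z : 'rV[R]_d => z 0 j - v 0 j)
    (fun t => t ^+ 2)); last exact: exprn_continuous.
  by apply: continuousB; [exact: coord_continuous|exact: cst_continuous].
by apply/funext => z; rewrite !mxE.
Qed.

(** By continuity of [norm2], the Euclidean ball contains a sup-norm ball, in which the rational
    coordinates can be chosen one by one. *)
Lemma norm2_rat_approx v (e : R) : 0 < e ->
  exists q : 'rV[rat]_d, norm2 (v - map_mx ratr q) < e.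
Proof.
move=> e0.
have : nbhs v [set u | norm2 (u - v) < e].
  apply: (@norm2_continuous v v [set t | t < e]).
  apply: open_nbhs_nbhs; split; first exact: open_lt.
  by rewrite /= subrr /norm2 big1 ?sqrtr0// => j _; rewrite mxE expr0n.
move=> /nbhs_ballP[r /= r0 rv].
have /(_ _)/cid-/all_sig[q qP] : forall j : 'I_d, exists t : rat,
    ratr t \in `]v 0 j - r, v 0 j + r[.
  by move=> j; apply: rat_in_itvoo; lra.
exists (\row_j q j); rewrite norm2_sym; apply: rv; split=> // i j.
rewrite (ord1 i) !mxE /ball /= distrC ltr_distl.
by have := qP j; rewrite in_itv.
Qed.

Lemma le_dist2 (e : R) v (S : set 'rV[R]_d) :
  (e%:E <= dist2 v S)%E <-> forall s, S s -> e <= norm2 (v - s).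
Proof.
split=> [eS s Ss|eS].
  by rewrite -lee_fin (le_trans eS)//; apply: ereal_inf_lbound; exists s.
by apply: le_ereal_inf_tmp => _ [s Ss <-]; rewrite lee_fin eS.
Qed.

Lemma closed_dist2_ge (e : R) (S : set 'rV[R]_d) :
  closed [set v | (e%:E <= dist2 v S)%E].
Proof.
rewrite (_ : [set v | _] = \bigcap_(s in S) [set v | e <= norm2 (v - s)]).
  apply: closed_bigI => s _.
  apply: (@preimage_closed _ _ (fun v => norm2 (v - s)) [set t | e <= t]).
    by move=> v _; exact: norm2_continuous.
  exact: closed_ge.
by apply/seteqP; split=> v /=; rewrite le_dist2.
Qed.

Lemma closed_norm2_le (e : R) v : closed [set u | norm2 (u - v) <= e].
Proof.
apply: (@preimage_closed _ _ (fun u => norm2 (u - v)) [set t | t <= e]).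
  by move=> u _; exact: norm2_continuous.
exact: closed_le.
Qed.

End norm2.

(** * Suprema, attained infima and random closed sets *)

(** The supremum need not be attained; the slack [m.+1%:R^-1] turns a superlevel event of a supremum
    into a countable intersection. *)
Lemma le_ereal_supP (R : realType) (S : set \bar R) (e : R) :
  (e%:E <= ereal_sup S)%E <->
  forall m : nat, exists2 y, S y & ((e - m.+1%:R^-1)%:E <= y)%E.
Proof.
split=> [eS m|eS].
  have /ereal_sup_gt[y Sy /ltW ey] : ((e - m.+1%:R^-1)%:E < ereal_sup S)%E.
    by rewrite (lt_le_trans _ eS)// lte_fin ltrBlDr ltrDl invr_gt0.
  by exists y.
apply/lee_subgt0Pr => r r0.
have [m /= mr] := ltr_add_invr (r0 : 0 < r).
have [y Sy ey] := eS m.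
rewrite (le_trans _ (ereal_sup_ubound Sy))// (le_trans _ ey)//.
rewrite -EFinB lee_fin lerB//; move: mr; rewrite add0r; exact: ltW.
Qed.

(** The near-minimizing sets [B e] generate a proper filter on [A]; any cluster point of it is a
    minimizer. *)
Lemma compact_lsc_attains_inf (R : realType) (T : topologicalType)
    (C A : set T) (q : T -> R) :
  A !=set0 -> A `<=` C -> compact A -> has_lbound [set q g | g in A] ->
  lower_semicontinuous (fun g : subspace C => (q g)%:E) ->
  exists2 g, A g & q g = inf [set q g | g in A].
Proof.
move=> A0 AC cA lbA lsc; set m := inf _.
have qA0 : [set q g | g in A] !=set0 by have [a Aa] := A0; exists (q a), a.
pose B (e : R) := [set g | A g /\ q g < m + e].
have B_near e : 0 < e -> B e !=set0.
  move=> e0; have [_ [g Ag <-] qg] := inf_adherent e0 (conj qA0 lbA).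
  by exists g.
pose F := filter_from [set e : R | 0 < e] B.
have FF : ProperFilter F.
  apply: filter_from_proper; last by move=> e /= /B_near.
  apply: filter_from_filter; first by exists 1 => /=.
  move=> e1 e2 /= e10 e20; exists (Num.min e1 e2) => /=.
    by rewrite lt_min e10 e20.
  by move=> g [Ag]; rewrite -ltrBlDl lt_min => /andP[g1 g2];
     split; split=> //; rewrite -ltrBlDl.
have FA : F A by exists 1 => //= g [].
have [g [Ag clg]] := cA F FF FA.
exists g => //; apply/le_anti; rewrite ge_inf// ?andbT; last by exists g.
rewrite leNgt; apply/negP => mg.
(* If [m < q g], semicontinuity keeps [q] above the midpoint of [m] and [q g] near [g], whereas
   [B ((q g - m) / 2)] keeps it below; a cluster point makes the two sets meet. *)
have [U] : exists2 U : set T, nbhs (g : subspace C) U &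
    forall z, U z -> (((m + q g) / 2)%:E < (q z)%:E)%E.
  by apply: lsc; rewrite lte_fin; lra.
move=> gU qU.
have {}gU : within C (nbhs g) U by rewrite (nbhs_subspace_in (AC _ Ag)).
have FB : F (B ((q g - m) / 2)) by exists ((q g - m) / 2) => //=; lra.
have [z [[Az qz] Uz]] := clg _ _ FB gU.
by have := qU _ (Uz (AC _ Az)); rewrite lte_fin; lra.
Qed.

(* Each excess event is a countable combination of hitting events at radii [e]
   minus a multiple of [m.+1%:R^-1], with balls centred at rational points. *)
Section random_closed_set.
Context {R : realType} {d : nat} {dP : measure_display} {P : measurableType dP}.
Variable K : P -> set 'rV[R]_d.
Hypothesis K_hit : forall A, closed A -> measurable [set p | K p `&` A !=set0].

Lemma measurable_excess_from (S : set 'rV[R]_d) (e : R) :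
  measurable [set p | (e%:E <= ereal_sup [set dist2 g S | g in K p])%E].
Proof.
rewrite (_ : [set p | _] = \bigcap_m [set p |
    K p `&` [set g | ((e - m.+1%:R^-1)%:E <= dist2 g S)%E] !=set0]).
  by apply: bigcap_measurableType => m _; exact/K_hit/closed_dist2_ge.
apply/seteqP; split=> p /=.
  by move=> /le_ereal_supP eK m _; have [_ [g Kg <-]] := eK m; exists g.
move=> eK; apply/le_ereal_supP => m; have [g [Kg eg]] := eK m I.
by exists (dist2 g S) => //; exists g.
Qed.

Lemma measurable_excess_to (S : set 'rV[R]_d) (e : R) :
  measurable [set p | (e%:E <= ereal_sup [set dist2 g (K p) | g in S])%E].
Proof.
pose r (m : nat) : R := m.+1%:R^-1.
have r0 m : 0 < r m by rewrite /r invr_gt0.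
pose c (q : 'rV[rat]_d) : 'rV[R]_d := map_mx ratr q.
(* Of the slack [2 * r m], one [r m] pays for a supremum that is not attained and one for moving the
   centre from [s] to the rational point [c q]. The condition on [S] does not involve [p]. *)
pose D m q := [set p | (exists2 s, S s & norm2 (s - c q) < r m) /\
   ~ (K p `&` [set u | norm2 (u - c q) <= e - 2 * r m] !=set0)].
rewrite (_ : [set p | _] = \bigcap_m \bigcup_q D m q).
  apply: bigcap_measurableType => m _.
  apply: countable_bigcupT_measurable => [|q]; first exact: countableP.
  have [Sq|Sq] := pselect (exists2 s, S s & norm2 (s - c q) < r m).
    rewrite (_ : D m q =
        ~` [set p | K p `&` [set u | norm2 (u - c q) <= e - 2 * r m] !=set0]).
      exact/measurableC/K_hit/closed_norm2_le.
    by apply/seteqP; split=> p //= [].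
  by rewrite (_ : D m q = set0)//; apply/seteqP; split=> p //= [].
apply/seteqP; split=> p /=.
  move=> /le_ereal_supP eK m _; have [_ [s Ss <-] /le_dist2 es] := eK m.
  have [q sq] := norm2_rat_approx s (r0 m).
  exists q => //; split; first by exists s.
  move=> [u [/es su /= uq]].
  have := norm2_triangle (c q) s u.
  by rewrite (norm2_sym (c q)) -/(r m) in su *; lra.
move=> eK; apply/lee_subgt0Pr => t t0.
(* Returning from [c q] to [s] loses a further [r m], so the total loss is [3 * r m < t]. *)
have [m /= mt] := ltr_add_invr (divr_gt0 t0 (ltr0n R 3) : 0 < t / 3).
rewrite add0r -/(r m) in mt.
have [q _ [[s Ss sq] Kq]] := eK m I.
apply: (@le_trans _ _ (dist2 s (K p))); last first.
  by apply: ereal_sup_ubound; exists s.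
rewrite -EFinB; apply/le_dist2 => u Ku; rewrite leNgt; apply/negP => su.
apply: Kq; exists u; split=> //=.
have := norm2_triangle s u (c q); rewrite (norm2_sym u s).
lra.
Qed.

Lemma measurable_hausdorff2_ge (S : set 'rV[R]_d) (e : R) :
  measurable [set p | (e%:E <= hausdorff2 (K p) S)%E].
Proof.
rewrite (_ : [set p | _] =
    [set p | (e%:E <= ereal_sup [set dist2 g S | g in K p])%E] `|`
    [set p | (e%:E <= ereal_sup [set dist2 g (K p) | g in S])%E]).
  by apply: measurableU; [exact: measurable_excess_from|
                          exact: measurable_excess_to].
apply/seteqP; split=> p /=; rewrite /hausdorff2 le_max.
  by case/orP; [left|right].
by case=> ->; rewrite ?orbT.
Qed.

End random_closed_set.

(** * Convergence in probability under the data law *)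

Section data_law.
Context {R : realType} {k : nat}.
Variable w : nat -> 'rV[R]_k.+1.
Hypothesis w_ge0 : forall i j, 0 <= w i 0 j.

Lemma data_law_ge0 n (A : set (obs k n)) : 0 <= data_law w A.
Proof. by apply: sumr_ge0 => y _; apply: prodr_ge0. Qed.

Lemma data_law_le_setU n (A B C : set (obs k n)) : A `<=` B `|` C ->
  data_law w A <= data_law w B + data_law w C.
Proof.
move=> ABC; rewrite /data_law !(big_mkcond (fun y => y \in _)) -big_split /=.
apply: ler_sum => y _; have w0 : 0 <= \prod_(i < n) w i 0 (tnth y i).
  exact: prodr_ge0.
case: ifPn => [/set_mem/ABC[/mem_set->|/mem_set->]|_].
- by rewrite lerDl; case: ifP.
- by rewrite lerDr; case: ifP.
- by rewrite addr_ge0//; case: ifP.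
Qed.

(** A union bound: where [Z] reaches [eta], one of the two deviations reaches [eta / 2]. *)
Lemma cvg_in_data_law_dominated (a b : R) (U W Z : forall n, obs k n -> R) :
  cvg_in_data_law w U a -> cvg_in_data_law w W b ->
  (\forall n \near \oo, forall y, `|Z n y| <= `|U n y - a| + `|W n y - b|) ->
  cvg_in_data_law w Z 0.
Proof.
move=> Ua Wb ZUW eta eta0.
have eta2 : 0 < eta / 2 by rewrite divr_gt0.
have /(_ _)-UWcvg := cvgD (Ua _ eta2) (Wb _ eta2); rewrite addr0 in UWcvg.
apply: (squeeze_cvgr _ (cvg_cst _) UWcvg).
apply: filterS ZUW => n ZUWn; rewrite data_law_ge0 /=.
apply: data_law_le_setU => y /=.
rewrite subr0 => etaZ.
have := ZUWn y; have [|Ueta ZUWy] := leP (eta / 2) `|U n y - a|; first by left.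
by right; rewrite /=; lra.
Qed.

End data_law.

(** * Bounds on posterior probabilities *)

Section posterior.
Context {R : realType} {k dx : nat} {dP : measure_display}
  {P : measurableType dP}.
Variables (ev : P -> 'rV[R]_dx -> 'rV[R]_k.+1) (x : nat -> 'rV[R]_dx).
Hypothesis ev_simplex : forall p i, simplex (ev p (x i)).

Lemma simplex_coord_le1 (v : 'rV[R]_k.+1) j : simplex v -> v 0 j <= 1.
Proof.
move=> [v0 <-]; rewrite (bigD1 j)//= lerDl.
by apply: sumr_ge0 => i _; exact: v0.
Qed.

Lemma likelihood_ge0 n (y : obs k n) p : 0 <= likelihood ev x y p.
Proof.
apply: prodr_ge0 => i _; apply: prodr_ge0 => j _; apply: exprn_ge0.
by case: (ev_simplex p i).
Qed.

Lemma likelihood_le1 n (y : obs k n) p : likelihood ev x y p <= 1.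
Proof.
have ev01 i j : 0 <= ev p (x i) 0 j <= 1.
  by rewrite simplex_coord_le1//; case: (ev_simplex p i) => ->.
apply: prodr_ile1 => i _; apply/andP; split.
  by apply: prodr_ge0 => j _; apply: exprn_ge0; case/andP: (ev01 i j).
apply: prodr_ile1 => j _; case/andP: (ev01 i j) => *.
by rewrite exprn_ge0//= exprn_ile1.
Qed.

Variables (Pi : probability P R) (n : nat) (y : obs k n).
Hypothesis mL : measurable_fun [set: P] (likelihood ev x y).

Let L := likelihood ev x y.
Let I (A : set P) := \int[Pi]_(p in A) L p.

Let integrableL A : measurable A -> Pi.-integrable A (EFin \o L).
Proof.
move=> mA; apply: (integrableS measurableT) => //.
apply: measurable_bounded_integrable => //.
  by rewrite (le_lt_trans (probability_le1 _ _))// ltry.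
exists 1; split=> // M M1 p _ /=.
by rewrite ger0_norm ?likelihood_ge0// (le_trans (likelihood_le1 _ _))// ltW.
Qed.

Let I_ge0 A : 0 <= I A.
Proof. by apply: Rintegral_ge0 => p _; exact: likelihood_ge0. Qed.

Let I_setU A B : measurable A -> measurable B -> A `&` B = set0 ->
  I (A `|` B) = I A + I B.
Proof.
move=> mA mB AB; apply: Rintegral_setU => //; first exact/integrableL/measurableU.
by rewrite disj_set2E AB eqxx.
Qed.

Let I_subset A B : measurable A -> measurable B -> A `<=` B -> I A <= I B.
Proof.
move=> mA mB AB; rewrite -(setDUK AB) I_setU ?lerDl//; first exact: measurableD.
by rewrite setDIK.
Qed.

Lemma posterior_ge0 (A : set P) : 0 <= posterior ev Pi x y A.
Proof. by rewrite divr_ge0// I_ge0. Qed.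

(** [E] is covered by the complements of [A] and [B], whose posterior probabilities are the
    deviations from 1 of those of [A] and [B]. *)
Lemma posterior_le_setC (E A B : set P) :
  measurable E -> measurable A -> measurable B -> A `&` B `<=` ~` E ->
  posterior ev Pi x y E <=
    `|posterior ev Pi x y A - 1| + `|posterior ev Pi x y B - 1|.
Proof.
move=> mE mA mB ABE; rewrite /posterior -/L -!/(I _).
(* If the evidence vanishes, the left-hand side is [0 / 0 = 0]. *)
have [->|D_neq0] := eqVneq (I setT) 0; first by rewrite invr0 mulr0 addr_ge0.
have D0 : 0 < I setT by rewrite lt_neqAle eq_sym D_neq0 I_ge0.
have IC S : measurable S -> I setT = I S + I (~` S).
  move=> mS; rewrite -I_setU ?setUv ?setICr//; exact: measurableC.
have postC S : measurable S -> I (~` S) / I setT = - (I S / I setT - 1).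
  move=> mS; have -> : I (~` S) = I setT - I S by rewrite (IC S mS) addrC addKr.
  by rewrite mulrBl divff// opprB.
suff : I E / I setT <= I (~` A) / I setT + I (~` B) / I setT.
  move=> /le_trans; apply; rewrite !postC// -!(normrN (_ - 1)).
  by rewrite lerD ?ler_norm.
rewrite -mulrDl ler_pM2r ?invr_gt0//.
have mAC : measurable (~` A) by exact: measurableC.
have mBC : measurable (~` B) by exact: measurableC.
(* Split [E] along [A]: the part inside [A] must avoid [B]. *)
have -> : I E = I (E `&` ~` A) + I (E `&` A).
  rewrite -I_setU -?setIUr ?setvU ?setIT//; [exact: measurableI..|].
  by rewrite setIACA setICl setI0.
apply: lerD; apply: I_subset => //; [exact: measurableI|exact: measurableI|].
by move=> p [Ep Ap] Bp; exact: (ABE p).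
Qed.

End posterior.

(** * Pseudo-identified sets: measurability and stability *)

Section criterion.
Context {R : realType} {dg : nat} {dP : measure_display}
  {P : measurableType dP}.
Variables (Gam : set 'rV[R]_dg) (q : 'rV[R]_dg -> P -> R).
Hypothesis q_ge0 : forall g p, Gam g -> 0 <= q g p.

Let q_lbound p A : A `<=` Gam -> has_lbound [set q g p | g in A].
Proof. by move=> AG; exists 0 => _ [g /AG Gg <-]; exact: q_ge0. Qed.

(** A minimizer over [Gam] lies in [A] exactly when the infima over [Gam] and over [Gam] intersected
    with [A] agree; the converse direction uses that the latter infimum is attained. *)
Lemma measurable_pseudo_id_hit A : compact Gam -> closed A ->
  (forall p, lower_semicontinuous (fun g : subspace Gam => (q g p)%:E)) ->
  (forall B, B !=set0 -> B `<=` Gam -> compact B ->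
     measurable_fun [set: P] (fun p => inf [set q g p | g in B])) ->
  measurable [set p | pseudo_id Gam q p `&` A !=set0].
Proof.
move=> cG cA lsc minf.
have cGA : compact (Gam `&` A) by exact: compact_closedI.
(* The empty case is treated apart: [inf] of an empty set is a default value, and [minf] covers only
   nonempty sets. *)
have [[g0 GAg0]|GA0] := pselect (Gam `&` A !=set0); last first.
  rewrite (_ : [set p | _] = set0)//; apply/seteqP; split=> p //= [g [[Gg _] Ag]].
  by apply: GA0; exists g.
have G0 : Gam !=set0 by exists g0; case: GAg0.
have mGA := minf _ (ex_intro _ _ GAg0) (@subIsetl _ _ _) cGA.
have mG := minf _ G0 (@subset_refl _ _) cG.
rewrite (_ : [set p | _] = [set: P] `&` (fun p =>
    inf [set q g p | g in Gam `&` A] == inf [set q g p | g in Gam])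
      @^-1` [set true]).
  exact: measurable_realfun.measurable_fun_eqr.
rewrite setTI; apply/seteqP; split=> p /=.
  move=> [g [[Gg /eqP]]]; rewrite subr_eq0 => /eqP qg Ag.
  apply/eqP/le_anti/andP; split.
    by rewrite -qg; apply: ge_inf; [exact: (q_lbound p (@subIsetl _ _ _))|exists g].
  apply: lb_le_inf; first by exists (q g0 p), g0.
  by move=> _ [h [Gh _] <-]; apply: ge_inf; [exact: q_lbound|exists h].
move=> /eqP infE.
have [g [Gg Ag] qg] := compact_lsc_attains_inf (ex_intro _ _ GAg0)
  (@subIsetl _ _ _) cGA (q_lbound p (@subIsetl _ _ _)) (lsc p).
by exists g; split=> //; split=> //; rewrite /Qtilde qg infE subrr.
Qed.

(** One [eta] comes from the criterion at [g], the other from the infimum over [Gam]. *)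
Lemma Qtilde_le_perturb g p p0 (eta : R) : pseudo_id Gam q p g ->
  (forall h, Gam h -> `|q h p - q h p0| <= eta) ->
  Qtilde Gam q g p0 <= 2 * eta.
Proof.
move=> [Gg]; rewrite /Qtilde => qg qeta.
have : inf [set q h p | h in Gam] - eta <= inf [set q h p0 | h in Gam].
  apply: lb_le_inf; first by exists (q g p0), g.
  move=> _ [h Gh <-]; rewrite lerBlDr.
  have : inf [set q h p | h in Gam] <= q h p.
    by apply: ge_inf; [exact: q_lbound|exists h].
  by have := qeta _ Gh; rewrite ler_norml => /andP[_]; lra.
by have := qeta _ Gg; rewrite ler_norml => /andP[]; lra.
Qed.

Lemma hausdorff2_pseudo_id_lt p p0 (e e' xi eta : R) :
  e' < e -> 2 * eta < xi ->
  (forall g, Gam g -> ~ pseudo_id_nbhd Gam q e' p0 g -> xi <= Qtilde Gam q g p0) ->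
  (forall g, Gam g -> `|q g p - q g p0| <= eta) ->
  (forall g, pseudo_id Gam q p0 g -> pseudo_id Gam q p `&` ball2 g e' !=set0) ->
  (hausdorff2 (pseudo_id Gam q p) (pseudo_id Gam q p0) < e%:E)%E.
Proof.
move=> ee' eta_xi sep close near.
(* Strict bounds on distances become weak under suprema, so the gap between [e'] and [e] restores
   strictness. *)
apply: (@le_lt_trans _ _ e'%:E); last by rewrite lte_fin.
rewrite /hausdorff2 ge_max; apply/andP; split.
  apply: ge_ereal_sup => _ [g Ig <-].
  have Gg : Gam g by case: Ig.
  have [[_ /ltW//]|/(sep g Gg)] := pselect (pseudo_id_nbhd Gam q e' p0 g).
  (* A minimizer for [p] outside the neighbourhood would have pseudo-criterion at [p0] at least [xi]
     and at most [2 * eta]. *)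
  by move=> xiQ; exfalso; have := Qtilde_le_perturb Ig close; lra.
apply: ge_ereal_sup => _ [g Ig <-].
have [h [Ih gh]] := near g Ig.
apply: (@le_trans _ _ (norm2 (g - h))%:E).
  by apply: ereal_inf_lbound; exists h.
by rewrite lee_fin norm2_sym ltW.
Qed.

End criterion.

(** * Posterior consistency of the pseudo-identified set *)

(** [limn_esup] is the infimum, over the sets of the filter, of the suprema on them; some such
    supremum is therefore below [e]. *)
Lemma limn_esup_eq0_near (R : realType) (u : (\bar R)^nat) (e : R) :
  limn_esup u = 0%E -> 0 < e -> \forall n \near \oo, (u n <= e%:E)%E.
Proof.
move=> u0 e0.
have [_ [V V_oo <-] supV] : exists2 y, [set ereal_sup [set u n | n in V]
    | V in \oo] y & (y < e%:E)%E.
  by apply: ereal_inf_lt; rewrite -[X in (X < _)%E]/(limn_esup u) u0 lte_fin.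
apply: filterS V_oo => n Vn; apply: le_trans (ltW supV).
by apply: ereal_sup_ubound; exists n.
Qed.

Theorem theorem6 (R : realType) (k dx dg df : nat)
  (* covariate space and law of the covariate sequence *)
  (X : set 'rV[R]_dx) (P0X : probability (seq_rV R dx) R)
  (P0X_X : {ae P0X, forall x : seq_rV R dx, forall i : nat, X (x i)})
  (* space of conditional PMFs, prior, true conditional PMF *)
  (dP : measure_display) (P : measurableType dP)
  (ev : P -> 'rV[R]_dx -> 'rV[R]_k.+1)
  (ev_simplex : forall p x, X x -> simplex (ev p x))
  (ev_inj : forall p p', (forall x, X x -> ev p x = ev p' x) -> p = p')
  (Pi : probability P R) (p0 : P)
  (* dominating measures for the marginal densities *)
  (nu : forall n : nat,
     {sigma_finite_measure set (n.-tuple (borel_rV R k.+1)) -> \bar R})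
  (* structural parameter space, moment function, criterion *)
  (Gam : set 'rV[R]_dg)
  (f : 'rV[R]_dx -> 'rV[R]_k.+1 -> 'rV[R]_dg -> 'rV[R]_df)
  (Q : forall n : nat, n.-tuple 'rV[R]_dx -> 'rV[R]_dg -> P -> R)
  (Q_ge0 : forall n (xs : n.-tuple 'rV[R]_dx) g p, (0 < n)%N ->
     (forall i, X (tnth xs i)) -> Gam g -> 0 <= Q n xs g p)
  (Q_dep : forall n (xs : n.-tuple 'rV[R]_dx) g p p', (0 < n)%N ->
     (forall i, X (tnth xs i)) -> Gam g ->
     (forall i, ev p (tnth xs i) = ev p' (tnth xs i)) ->
     Q n xs g p = Q n xs g p')
  (Q_eq0 : forall n (xs : n.-tuple 'rV[R]_dx) g p, (0 < n)%N ->
     (forall i, X (tnth xs i)) -> Gam g ->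
     (Q n xs g p = 0 <->
      forall (i : 'I_n) (j : 'I_df),
        0 <= f (tnth xs i) (ev p (tnth xs i)) g 0 j))
  (A1 : forall n, (0 < n)%N -> {ae P0X, forall x : seq_rV R dx,
     measurable_fun [set: obs k n * P]
       (fun z => likelihood ev x z.1 z.2)})
  (A2 : forall n, (0 < n)%N -> {ae P0X, forall x : seq_rV R dx,
     has_density Pi (marginal ev x n) (nu n) /\
     data_law (fun i => ev p0 (x i))
       (~` [set y : obs k n |
             (0 < \int[Pi]_p (likelihood ev x y p)%:E < +oo)%E]) = 0})
  (A3 : compact Gam)
  (A4 : forall n, (0 < n)%N -> {ae P0X, forall x : seq_rV R dx,
     (forall p, lower_semicontinuous
        (fun g : subspace Gam => (Q n (init_tuple n x) g p)%:E)) /\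
     (forall A : set 'rV[R]_dg, A !=set0 -> A `<=` Gam -> compact A ->
        measurable_fun [set: P]
          (fun p => inf [set Q n (init_tuple n x) g p | g in A]))})
  (A5 : {ae P0X, forall x : seq_rV R dx,
     forall eps : R, 0 < eps ->
     exists (xi : R) (N : nat), [/\ 0 < xi, (1 <= N)%N
       & forall n, (N <= n)%N ->
         (forall g, Gam g ->
            ~ pseudo_id_nbhd Gam (Q n (init_tuple n x)) eps p0 g ->
            xi <= Qtilde Gam (Q n (init_tuple n x)) g p0) /\
         compact [set g | Gam g /\ xi <= Qtilde Gam (Q n (init_tuple n x)) g p0]]})
  (A6 : {ae P0X, forall x : seq_rV R dx,
     exists (dd : nat -> P -> P -> R) (delta : nat -> R) (Pn : nat -> set P),
     let V := fun n => Pn n `&` [set p | dd n p p0 < delta n] in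
     [/\ (forall n, semimetric (dd n)) /\
         (nonincreasing_seq delta /\ delta @ \oo --> (0 : R)),
         forall n, measurable (Pn n) /\
           measurable [set p | dd n p p0 < delta n],
         cvg_in_data_law (fun i => ev p0 (x i))
           (fun n y => posterior ev Pi x y (Pn n)) 1 /\
         cvg_in_data_law (fun i => ev p0 (x i))
           (fun n y => posterior ev Pi x y [set p | dd n p p0 < delta n]) 1,
         limn_esup (fun n => ereal_sup
           [set `|Q n (init_tuple n x) z.1 z.2 - Q n (init_tuple n x) z.1 p0|%:E
              | z in Gam `*` V n]) = 0%E
       & forall eps : R, 0 < eps -> exists N : nat, (1 <= N)%N /\
           forall n p, V n p -> (N <= n)%N ->
           forall g, pseudo_id Gam (Q n (init_tuple n x)) p0 g ->
             pseudo_id Gam (Q n (init_tuple n x)) p `&` ball2 g eps !=set0]}) :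
  {ae P0X, forall x : seq_rV R dx, forall eps : R, 0 < eps ->
     let E := fun n => [set p | (eps%:E <=
       hausdorff2 (pseudo_id Gam (Q n (init_tuple n x)) p)
                  (pseudo_id Gam (Q n (init_tuple n x)) p0))%E] in
     (forall n, (0 < n)%N -> measurable (E n)) /\
     cvg_in_data_law (fun i => ev p0 (x i))
       (fun n y => posterior ev Pi x y (E n)) 0}.
Proof.
(* A countable union of null sets gives one null set for all [n]; the index 0 is filled in
   vacuously. *)
have ae_pos (S : nat -> seq_rV R dx -> Prop) :
    (forall n, (0 < n)%N -> {ae P0X, forall x, S n x}) ->
    {ae P0X, forall x, forall n, (0 < n)%N -> S n x}.
  move=> Sae; apply: ae_foralln => -[|n]; first exact: aeW.
  by apply: filterS (Sae n.+1 isT) => x + _.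
have aeI := @filterI _ _ (ae_filter_ringOfSetsType P0X).
have AX := aeI _ _ P0X_X (aeI _ _ (ae_pos _ A1) (aeI _ _ (ae_pos _ A4)
  (aeI _ _ A5 A6))).
apply: (filterS _ AX) => x [Xx [mL [lsc_inf [sep]]]].
move=> [dd [delta [Pn [_ mPn [cvgPn cvgdd] supQ near]]]] eps eps0.
have w_simplex p i : simplex (ev p (x i)) by exact: ev_simplex.
pose q n := Q n (init_tuple n x).
pose E n := [set p | (eps%:E <=
  hausdorff2 (pseudo_id Gam (q n) p) (pseudo_id Gam (q n) p0))%E].
have q_ge0 n g p : (0 < n)%N -> Gam g -> 0 <= q n g p.
  by move=> n0 Gg; apply: Q_ge0 => // i; rewrite tnth_mktuple.
have mE n : (0 < n)%N -> measurable (E n).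
  move=> n0; have [lsc minf] := lsc_inf n n0.
  apply: measurable_hausdorff2_ge => A cA.
  by apply: measurable_pseudo_id_hit => // g p; exact: q_ge0.
split=> //.
(* Radius [eps / 2] leaves room for the strict bound by [eps]; closeness [xi / 4] is used below
   since [2 * (xi / 4) < xi]. *)
have [xi [N [xi0 _ sepN]]] := sep _ (divr_gt0 eps0 (ltr0n R 2)).
have [M [_ nearM]] := near _ (divr_gt0 eps0 (ltr0n R 2)).
apply: (cvg_in_data_law_dominated _ cvgPn cvgdd).
  by move=> i j; case: (w_simplex p0 i).
apply: filterS2 (limn_esup_eq0_near supQ (divr_gt0 xi0 (ltr0n R 4)))
  (nbhs_infty_ge (maxn 1 (maxn N M))) => n supQn.
rewrite /= !geq_max => /and3P[n0 Nn Mn] y.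
(* A section of the jointly measurable likelihood at fixed [y]. *)
have mLy : measurable_fun [set: P] (likelihood ev x y).
  exact: (measurableT_comp (mL n n0) (pair1_measurable y)).
rewrite ger0_norm ?posterior_ge0//.
apply: posterior_le_setC => //; [exact: mE|by case: (mPn n)..|].
(* It remains to see that the Hausdorff distance is below [eps] on the intersection of [Pn n] and
   the [dd n]-ball. *)
move=> p Vp; rewrite /E /=; apply/negP; rewrite -ltNge.
apply: (@hausdorff2_pseudo_id_lt _ _ _ _ _ _ _ p p0 eps (eps / 2) xi (xi / 4)).
- by move=> g p'; exact: q_ge0.
- lra.
- lra.
- by move=> g; apply: (sepN n Nn).1.
- move=> g Gg; rewrite -lee_fin; apply: (le_trans _ supQn).
  by apply: ereal_sup_ubound; exists (g, p).
- by move=> g; exact: nearM.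
Qed.
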